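(* Let $\mathcal{A}=(A,\lambda)$ with $A\in\mathrm{GL}_2^+(F)$ and $\lambda\in\mathrm{Cl}^+(F)$. The class of $A$ in $\Gamma_{1,\lambda}(\mathfrak{n})\backslash\mathrm{GL}_2^+(F)$ is fixed under right multiplication by some upper triangular matrix $A'=\begin{pmatrix}x&y\\0&z\end{pmatrix}\in\mathrm{GL}_2^+(F)$ with $\mathrm{N}(z)<0$ if and only if $\mathcal{A}$ is not admissible.
   Context: $F$ is a totally real number field of degree $n$ with ring of integers $\mathcal{O}_F$, different $\mathfrak{d}$, narrow class group $\mathrm{Cl}^+(F)$, and group of totally positive units $\mathcal{O}_{F,+}^*$. $\mathrm{GL}_2^+(F)$ denotes the $2\times2$ invertible matrices over $F$ with totally positive determinant. Fix an integral ideal $\mathfrak{n}$ (the level) and, for each $\lambda\in\mathrm{Cl}^+(F)$, a fractional ideal $\mathfrak{t}_\lambda$ in the class $\lambda$ that is coprime to $\mathfrak{n}$. Define $\Gamma_{1,\lambda}(\mathfrak{n})$ to be the set of $\begin{pmatrix}a&b\\c&d\end{pmatrix}\in\mathrm{GL}_2^+(F)$ with $a,d\in\mathcal{O}_F$, $c\in\mathfrak{t}_\lambda\mathfrak{d}\mathfrak{n}$, $b\in(\mathfrak{t}_\lambda\mathfrak{d})^{-1}$, $ad-bc\in\mathcal{O}_F^*$ and $d\equiv1\pmod{\mathfrak{n}}$. For a pair $\mathcal{A}=(A,\lambda)$ with $A=\begin{pmatrix}a&b\\c&d\end{pmatrix}\in\mathrm{GL}_2^+(F)$ define the fractional ideal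 $\mathfrak{b}_\mathcal{A}=a\mathcal{O}_F+c(\mathfrak{t}_\lambda\mathfrak{d})^{-1}$, the coprime integral ideals $\mathfrak{a}_\mathcal{A}=a\mathfrak{b}_\mathcal{A}^{-1}$, $\mathfrak{c}_\mathcal{A}=c(\mathfrak{t}_\lambda\mathfrak{d}\mathfrak{b}_\mathcal{A})^{-1}$, and $\mathfrak{m}_\mathcal{A}=\gcd(\mathfrak{c}_\mathcal{A},\mathfrak{n})$. A pair of ideals $(\mathfrak{m},\mathfrak{n})$ with $\mathfrak{m}\mid\mathfrak{n}$ is admissible if there do not exist units $\epsilon_1,\epsilon_2\in\mathcal{O}_F^*$ with $\epsilon_1\equiv1\pmod{\mathfrak{m}}$, $\epsilon_2\equiv1\pmod{\mathfrak{n}/\mathfrak{m}}$, $\mathrm{N}\epsilon_1=\mathrm{N}\epsilon_2=-1$ and $\epsilon_1/\epsilon_2$ totally positive. A pair $\mathcal{A}=(A,\lambda)$ is admissible if $(\mathfrak{m}_\mathcal{A},\mathfrak{n})$ is admissible. *)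

(* Defs.v *)
From HB Require Import structures.
From mathcomp Require Import all_boot all_order all_algebra all_field.
Set Implicit Arguments. Unset Strict Implicit. Unset Printing Implicit Defensive.
Import Order.TTheory GRing.Theory Num.Theory.
Local Open Scope ring_scope.

Section NF.
Variable L : fieldExtType rat.

Definition mulmx_of (x : L) : 'M[rat]_(\dim {:L}) :=
  passmx.mxof (vbasis {:L}) (vbasis {:L}) (amulr x).
Definition nf_norm (x : L) : rat := \det (mulmx_of x).
Definition nf_trace (x : L) : rat := \tr (mulmx_of x).

Definition totally_real : Prop :=
  forall (s : {rmorphism L -> algC}) (x : L), s x \is Num.real.
Definition totpos (x : L) : Prop :=
  forall (s : {rmorphism L -> algC}), 0 < s x.

Definition OK (x : L) : Prop :=
  exists p : {poly int}, p \is monic /\ root (map_poly (fun z : int => z%:~R) p) x.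
Definition OKunit (x : L) : Prop := x != 0 /\ OK x /\ OK x^-1.

Definition idl := L -> Prop.

Definition submodule (I : idl) : Prop :=
  I 0 /\ (forall x y, I x -> I y -> I (x + y)) /\
  (forall r x, OK r -> I x -> I (r * x)).
Definition frac_ideal (I : idl) : Prop :=
  submodule I /\ (exists x, x != 0 /\ I x) /\
  (exists d, d != 0 /\ OK d /\ forall x, I x -> OK (d * x)).
Definition integral_ideal (I : idl) : Prop :=
  frac_ideal I /\ forall x, I x -> OK x.

Definition scale_idl (a : L) (I : idl) : idl := fun x => exists y, I y /\ x = a * y.
Definition principal (a : L) : idl := scale_idl a OK.
Definition sum_idl (I J : idl) : idl := fun x => exists y z, I y /\ J z /\ x = y + z.
Definition mul_idl (I J : idl) : idl := fun x =>
  exists s : seq (L * L), (forall p, p \in s -> I p.1 /\ J p.2) /\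
                          x = \sum_(p <- s) p.1 * p.2.
Definition inv_idl (I : idl) : idl := fun x => forall y, I y -> OK (x * y).
Definition congr_idl (I : idl) (x y : L) : Prop := I (x - y).

Definition codifferent : idl := fun x => forall y, OK y -> nf_trace (x * y) \is a Num.int.
Definition different : idl := inv_idl codifferent.

(* a fractional ideal t is coprime to the integral ideal n, i.e. v_p(t) = 0
   for every prime p | n; equivalently (t cap O_F) + n = O_F and
   (t^-1 cap O_F) + n = O_F *)
Definition coprime_frac (t n : idl) : Prop :=
  (forall x, OK x <-> sum_idl (fun y => t y /\ OK y) n x) /\
  (forall x, OK x <-> sum_idl (fun y => inv_idl t y /\ OK y) n x).

Definition GLp (A : 'M[L]_2) : Prop := totpos (\det A).

Definition e11 (A : 'M[L]_2) := A ord0 ord0.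
Definition e12 (A : 'M[L]_2) := A ord0 ord_max.
Definition e21 (A : 'M[L]_2) := A ord_max ord0.
Definition e22 (A : 'M[L]_2) := A ord_max ord_max.

Definition upper (x y z : L) : 'M[L]_2 :=
  \matrix_(i < 2, j < 2)
    if (i == ord0) then (if j == ord0 then x else y)
    else (if j == ord0 then 0 else z).

(* Gamma_{1,lambda}(n) with t = t_lambda *)
Definition Gamma1 (t n : idl) (g : 'M[L]_2) : Prop :=
  GLp g /\ OK (e11 g) /\ OK (e22 g) /\
  mul_idl (mul_idl t different) n (e21 g) /\
  inv_idl (mul_idl t different) (e12 g) /\
  OKunit (\det g) /\ congr_idl n (e22 g) 1.

Definition b_A (t : idl) (A : 'M[L]_2) : idl :=
  sum_idl (principal (e11 A)) (scale_idl (e21 A) (inv_idl (mul_idl t different))).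
Definition a_A (t : idl) (A : 'M[L]_2) : idl := scale_idl (e11 A) (inv_idl (b_A t A)).
Definition c_A (t : idl) (A : 'M[L]_2) : idl :=
  scale_idl (e21 A) (inv_idl (mul_idl (mul_idl t different) (b_A t A))).
Definition m_A (t n : idl) (A : 'M[L]_2) : idl := sum_idl (c_A t A) n.

Definition admissible_pair (m n : idl) : Prop :=
  ~ exists e1 e2 : L,
      [/\ OKunit e1, OKunit e2, congr_idl m e1 1,
          congr_idl (mul_idl n (inv_idl m)) e2 1 &
          [/\ nf_norm e1 = -1, nf_norm e2 = -1 & totpos (e1 / e2)]].

Definition admissible (t n : idl) (A : 'M[L]_2) : Prop :=
  admissible_pair (m_A t n A) n.

End NF.

(* Main.v *)
Require Import Defs.
From HB Require Import structures.
From mathcomp Require Import all_boot all_order all_algebra all_field.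
From mathcomp Require Import ring.
From Stdlib Require Import Classical.
Import Order.TTheory GRing.Theory Num.Theory.
Local Open Scope ring_scope.
Set Implicit Arguments. Unset Strict Implicit. Unset Printing Implicit Defensive.

(* Write D for the ideal t d, (a, c) for the first column of A and b for b_A.  A matrix
   g in Gamma_1 with A U = g A, U = (x, y; 0, z), preserves the lattice O + D, acts by
   x on its intersection b^-1 (a, c) with the line of (a, c), by z on the quotient, and
   trivially on the second coordinate modulo n D.  The second coordinate maps that
   intersection onto m_A D modulo n D; hence x = 1 mod n / m_A and z = 1 mod m_A.  Both
   are units, z / x is totally positive because x z is, and N z < 0, so (z, x)
   violates admissibility.  Conversely, with f in b^-1 and h in (D b)^-1 such that
   a f + c h = 1, the matrices fixing the line of (a, c) with eigenvalues
   x = e2, z = e1 are explicit, and the two congruences leave room to choose the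
   remaining parameter so that g lies in Gamma_1.
   This needs fractional ideals of O to be invertible.  They are finitely generated by
   means of the trace form; and if the coefficients of f generate I, some multiple f q
   has rational integer coefficients, with gcd g say.  By Dedekind's Prague theorem
   the products of a coefficient of f and one of q / g are integral, while Bezout in Z
   writes 1 as a combination of such products. *)

(** * Complex embeddings, norm and trace *)

Section Embeddings.
Variable L : fieldExtType rat.
Implicit Types x y : L.

Lemma mulmx_of_linear : linear (@mulmx_of L).
Proof. by move=> a x y; rewrite /mulmx_of linearP passmx.mxof_linear. Qed.
HB.instance Definition _ :=
  GRing.isSemilinear.Build rat L _ _ (@mulmx_of L) (GRing.semilinear_linear mulmx_of_linear).

Lemma mulmx_ofM x y : mulmx_of (x * y) = mulmx_of x *m mulmx_of y.
Proof.
rewrite /mulmx_of -passmx.mxof_comp ?vbasisP //; congr passmx.mxof.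
by apply/lfunP=> v; rewrite comp_lfunE !lfunE /= mulrA.
Qed.

Lemma mulmx_of1 : mulmx_of (1 : L) = 1%:M.
Proof.
rewrite /mulmx_of -(passmx.mxof1 (basis_free (vbasisP _))); congr passmx.mxof.
by apply/lfunP=> v; rewrite !lfunE /= mulr1.
Qed.

Local Notation MC x := (map_mx (ratr : rat -> algC) (mulmx_of x)).

Lemma mulmx_ofC x y : comm_mx (MC x) (MC y).
Proof. by rewrite /comm_mx -!map_mxM -!mulmx_ofM mulrC. Qed.

(** The eigenvalues on a common eigenvector inherit the ring laws of [mulmx_of]. A coordinate where
    [v] does not vanish reads them off, so [f] needs no choice. *)
Lemma embedding_of_eigenvector (v : 'rV[algC]_(\dim {:L})) :
    v != 0 -> (forall x, exists a, v *m MC x = a *: v) ->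
  exists s : {rmorphism L -> algC}, forall x, v *m MC x = s x *: v.
Proof.
move=> v0 Hv; have [i vi0] := rV0Pn v v0.
pose f x : algC := (v *m MC x) 0 i / v 0 i.
have fE x : v *m MC x = f x *: v.
  have [a va] := Hv x; rewrite va; congr (_ *: v).
  by rewrite /f va mxE mulfK.
have fU x a : v *m MC x = a *: v -> f x = a.
  by rewrite /f => ->; rewrite mxE mulfK.
have fB : zmod_morphism f.
  move=> x y; apply: fU.
  by rewrite raddfB map_mxB mulmxBr !fE scalerBl.
have fM : monoid_morphism f.
  split; first by apply: fU; rewrite mulmx_of1 map_mx1 mulmx1 scale1r.
  move=> x y; apply: fU.
  by rewrite mulmx_ofM map_mxM mulmxA fE -scalemxAl fE scalerA.
pose s : {rmorphism L -> algC} := HB.pack f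
  (GRing.isZmodMorphism.Build L algC f fB) (GRing.isMonoidMorphism.Build L algC f fM).
by exists s.
Qed.

(* The eigenspace is stable under the commuting family of all multiplications,
   hence contains a common eigenvector, whose eigenvalues form an embedding. *)
Lemma eigenvalue_embedding x a :
  eigenvalue (MC x) a -> exists s : {rmorphism L -> algC}, s x = a.
Proof.
move=> ea; pose E := eigenspace (MC x) a.
have st y : stablemx E (MC y) by apply: comm_mx_stable_eigenspace; apply: mulmx_ofC.
pose As := [seq restrictmx E (MC y) | y <- vbasis {:L}].
have [||v v0 /allP vP] := @common_eigenvector _ _ As.
- by rewrite lt0n mxrank_eq0.
- move=> _ _ /mapP[y _ ->] /mapP[z _ ->].
  rewrite /comm_mx -?conjmxM ?inE ?stablemx_row_base ?st //.
  by rewrite mulmx_ofC.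
pose w := v *m row_base E.
have w0 : w != 0 by rewrite mulmx_free_eq0 ?row_base_free.
have wE : (w <= E)%MS by rewrite mulmx_sub // eq_row_base.
have wb y : y \in vbasis {:L} -> exists c, w *m MC y = c *: w.
  move=> yb; have /vP : restrictmx E (MC y) \in As by apply: map_f.
  rewrite /w stablemx_restrict ?st // => /eigenvectorP[c /eigenspaceP]; by exists c.
have wall y : exists c, w *m MC y = c *: w.
  rewrite (coord_basis (vbasisP {:L}) (memvf y)); elim/big_ind: _.
  - by exists 0; rewrite raddf0 map_mx0 mulmx0 scale0r.
  - move=> y1 y2 [c1 e1] [c2 e2]; exists (c1 + c2).
    by rewrite raddfD map_mxD mulmxDr e1 e2 scalerDl.
  - move=> i _; have [|c ec] := wb ((vbasis {:L})`_i); first by rewrite mem_nth ?size_tuple.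
    exists (ratr (coord (vbasis {:L}) i y) * c).
    by rewrite linearZ map_mxZ -scalemxAr ec scalerA.
have [s sP] := embedding_of_eigenvector w0 wall.
exists s; have /eigenspaceP := wE; rewrite sP => /eqP.
by rewrite -subr_eq0 -scalerBl scaler_eq0 (negPf w0) orbF subr_eq0 => /eqP.
Qed.

(** Each root in [algC] is an eigenvalue, hence the value at [x] of some embedding. The list may
    depend on [x], which suffices for integrality and positivity of norms and traces. *)
Lemma char_poly_embeddings x : exists ss : seq {rmorphism L -> algC},
  map_poly ratr (char_poly (mulmx_of x)) = \prod_(s <- ss) ('X - (s x)%:P).
Proof.
have [rs Ers] := closed_field_poly_normal (char_poly (MC x)).
rewrite map_char_poly; move: Ers; rewrite (monicP (char_poly_monic _)) scale1r => Ers.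
have : forall r, r \in rs -> exists s : {rmorphism L -> algC}, s x = r.
  move=> r rrs; apply: eigenvalue_embedding.
  by rewrite eigenvalue_root_char Ers root_prod_XsubC.
rewrite {}Ers; elim: rs => [|r rs IH] H; first by exists [::]; rewrite !big_nil.
have [s sx] := H r (mem_head _ _).
have [|ss IHs] := IH; first by move=> r' r'rs; apply: H; rewrite inE r'rs orbT.
by exists (s :: ss); rewrite !big_cons IHs sx.
Qed.

(** An empty list would give a characteristic polynomial of degree 0, but its degree is the positive
    dimension of [L]. *)
Lemma embedding_exists : exists s : {rmorphism L -> algC}, true.
Proof.
have [[|s ss] E] := char_poly_embeddings (0 : L); last by exists s.
have := congr1 (fun p : {poly algC} => size p) E.
rewrite big_nil size_poly1 size_map_poly size_char_poly => /eqP.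
by rewrite eqSS dimv_eq0 => /eqP/vspaceP/(_ 1); rewrite memvf memv0 oner_eq0.
Qed.

Lemma nf_norm_trace_embeddings x : exists ss : seq {rmorphism L -> algC},
  ratr (nf_norm x) = \prod_(s <- ss) s x /\ ratr (nf_trace x) = \sum_(s <- ss) s x.
Proof.
have dim_gt0 : (0 < \dim {:L})%N.
  by rewrite lt0n dimv_eq0; apply/eqP=> /vspaceP/(_ 1); rewrite memvf memv0 oner_eq0.
have [ss E] := char_poly_embeddings x; exists ss.
have szss : size ss = \dim {:L}.
  have := congr1 (fun p : {poly algC} => size p) E.
  by rewrite size_map_poly size_char_poly size_prod_XsubC => -[].
have E' : map_poly ratr (char_poly (mulmx_of x)) =
    \prod_(r <- [seq s x | s : {rmorphism L -> algC} <- ss]) ('X - r%:P).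
  by rewrite big_map.
split.
  have := congr1 (fun p : {poly algC} => p`_0) E'.
  rewrite coef_map /= char_poly_det coef0_prod_XsubC size_map szss big_map.
  rewrite rmorphM rmorphXn rmorphN1 => /(mulfI _); apply.
  by rewrite expf_neq0 // oppr_eq0 oner_eq0.
have := congr1 (fun p : {poly algC} => p`_(\dim {:L}).-1) E'.
rewrite coef_map /= char_poly_trace // -{2}szss -(size_map (fun s : {rmorphism L -> algC} => s x)).
rewrite coefPn_prod_XsubC ?size_map ?szss -?lt0n // big_map rmorphN.
by move/oppr_inj.
Qed.

End Embeddings.

(** * Algebraic integers *)

(** Integrality is transitive: the coefficients are integral over the rational integers through
    their [minCpoly], hence so is the root. *)
Lemma Aint_root_monic (p : {poly algC}) (u : algC) :
  p \is monic -> p \is a polyOver Aint -> root p u -> u \in Aint.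
Proof.
move=> mon_p Ap pu.
have intP (z : algC) : z \in Aint -> integralOver (intr : int -> algC) z.
  move=> /floorpP[q Eq]; exists q; last by rewrite -Eq root_minCpoly.
  have := minCpoly_monic z; rewrite Eq => /monicP.
  rewrite lead_coef_map_inj //; last exact: intr_inj.
  by move=> lq; apply/monicP/(@intr_inj algC).
have intp : {in p : seq algC, integralRange (intr : int -> algC)}.
  by move=> z zp; apply: intP; apply: (allP Ap).
have [q mon_q qu] := integral_root_monic mon_p pu intp.
apply: root_monic_Aint qu _ _; first exact: monic_map.
by apply/polyOverP=> i; rewrite coef_map /= rpred_int.
Qed.

Section Integers.
Variable L : fieldExtType rat.
Implicit Types x y : L.

(** An embedding is injective and fixes integer coefficients, so [x] and [s x] are roots of the same
    integer polynomials. Ring closure of [OK] is then inherited from [Aint]. *)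
Lemma OK_Aint (s : {rmorphism L -> algC}) x : OK x <-> s x \in Aint.
Proof.
have sE (p : {poly int}) : root (map_poly intr p) x = root (map_poly intr p) (s x).
  rewrite -(fmorph_root s) -map_poly_comp; congr root.
  by apply: eq_map_poly => z /=; rewrite rmorph_int.
split=> [[p [mon_p]] | /floorpP[p Ep]].
  rewrite sE => /root_monic_Aint; apply; first exact: monic_map.
  by apply/polyOverP=> i; rewrite coef_map /= rpred_int.
exists p; split; last by rewrite sE -Ep root_minCpoly.
have := minCpoly_monic (s x); rewrite Ep => /monicP.
rewrite lead_coef_map_inj //; last exact: intr_inj.
by move=> lq; apply/monicP/(@intr_inj algC).
Qed.

Lemma OK_int (m : int) : OK (m%:~R : L).
Proof. by have [s _] := embedding_exists L; apply/(OK_Aint s); rewrite rmorph_int Aint_int. Qed.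
Lemma OK0 : OK (0 : L). Proof. exact: (OK_int 0). Qed.
Lemma OK1 : OK (1 : L). Proof. exact: (OK_int 1). Qed.
Lemma OKD x y : OK x -> OK y -> OK (x + y).
Proof.
have [s _] := embedding_exists L; move=> /(OK_Aint s) Ax /(OK_Aint s) Ay.
by apply/(OK_Aint s); rewrite rmorphD rpredD.
Qed.
Lemma OKM x y : OK x -> OK y -> OK (x * y).
Proof.
have [s _] := embedding_exists L; move=> /(OK_Aint s) Ax /(OK_Aint s) Ay.
by apply/(OK_Aint s); rewrite rmorphM rpredM.
Qed.
Lemma OKN x : OK x -> OK (- x).
Proof. by move=> Ox; rewrite -mulN1r; apply: OKM Ox; exact: (OK_int (-1)). Qed.
Lemma OKB x y : OK x -> OK y -> OK (x - y).
Proof. by move=> Ox Oy; apply: OKD => //; apply: OKN. Qed.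

(** In the application [b] and [c] are the trace and determinant of [g], and [u] is one of its
    eigenvalues. *)
Lemma OK_quadratic (u b c : L) : OK b -> OK c -> u ^+ 2 - b * u + c = 0 -> OK u.
Proof.
have [s _] := embedding_exists L; move=> /(OK_Aint s) Ab /(OK_Aint s) Ac E.
apply/(OK_Aint s); pose p : {poly algC} := 'X^2 + ((s c)%:P - s b *: 'X).
pose r : {poly algC} := (s c)%:P - s b *: 'X.
have sz : (size r < 3)%N.
  rewrite /r (leq_ltn_trans (size_polyD _ _)) // gtn_max size_polyN.
  rewrite (leq_ltn_trans (size_polyC_leq1 _)) //=.
  by rewrite (leq_ltn_trans (size_scale_leq _ _)) // size_polyX.
apply: (@Aint_root_monic p).
- by apply/monicP; rewrite /p lead_coefDl ?size_polyXn // lead_coefXn.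
- by rewrite /p rpredD ?rpredX ?polyOverX // rpredB ?polyOverC ?polyOverZ ?polyOverX.
- rewrite /root /p !hornerE; apply/eqP.
  transitivity (s (u ^+ 2 - b * u + c)); last by rewrite E rmorph0.
  by rewrite rmorphD rmorphB rmorphXn rmorphM addrAC.
Qed.

Lemma rat_Aint_int (q : rat) : ratr q \in Aint -> q \is a Num.int.
Proof. by move=> Aq; rewrite -Cint_rat Cint_rat_Aint ?Crat_rat. Qed.

Lemma nf_trace_int x : OK x -> nf_trace x \is a Num.int.
Proof.
move=> Ox; have [ss [_ E]] := nf_norm_trace_embeddings x.
by apply: rat_Aint_int; rewrite E rpred_sum // => s _; apply/OK_Aint.
Qed.

Lemma nf_norm_int x : OK x -> nf_norm x \is a Num.int.
Proof.
move=> Ox; have [ss [E _]] := nf_norm_trace_embeddings x.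
by apply: rat_Aint_int; rewrite E rpred_prod // => s _; apply/OK_Aint.
Qed.

Lemma nf_norm_totpos x : totpos x -> 0 < nf_norm x.
Proof.
move=> px; have [ss [E _]] := nf_norm_trace_embeddings x.
by rewrite -(ltr0q algC) E prodr_gt0.
Qed.

Lemma nf_normM x y : nf_norm (x * y) = nf_norm x * nf_norm y.
Proof. by rewrite /nf_norm mulmx_ofM det_mulmx. Qed.

Lemma nf_norm1 : nf_norm (1 : L) = 1.
Proof. by rewrite /nf_norm mulmx_of1 det1. Qed.

Lemma nf_norm_unit x : OKunit x -> nf_norm x = 1 \/ nf_norm x = -1.
Proof.
case=> x0 [Ox Oi]; have := nf_normM x x^-1; rewrite divff // nf_norm1.
have /intrP[a ->] := nf_norm_int Ox; have /intrP[b ->] := nf_norm_int Oi.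
rewrite -intrM -[LHS]/(1%:~R) => /intr_inj ab.
have : a \is a GRing.unit by apply/unitrP; exists b; rewrite mulrC -ab.
by rewrite qualifE /= => /orP[]/eqP->; [left | right].
Qed.

(** The left side is the trace of 1, that is, the degree. It is written as the pairing of [x] with
    its inverse, the form in which nondegeneracy is applied. *)
Lemma nf_trace_nondegenerate x : x != 0 -> nf_trace (x * x^-1) != 0.
Proof.
move=> x0; rewrite divff // /nf_trace mulmx_of1 mxtrace1 pnatr_eq0 dimv_eq0.
by apply/eqP=> /vspaceP/(_ 1); rewrite memvf memv0 oner_eq0.
Qed.

Lemma nf_traceB x y : nf_trace (x - y) = nf_trace x - nf_trace y.
Proof. by rewrite /nf_trace raddfB raddfB. Qed.

Lemma intL_neq0 (m : int) : m != 0 -> m%:~R != 0 :> L.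
Proof. by rewrite -(rmorph_int (in_alg L)) fmorph_eq0 intr_eq0. Qed.

End Integers.

(** * Dedekind's Prague theorem *)

(** With [a] the leading coefficient and [k.+1] the degree, [a ^+ k * h] rewritten in the variable
    [a * X] is monic with integral coefficients. *)
Lemma Aint_lead_root (h : {poly algC}) (r : algC) :
  h \is a polyOver Aint -> root h r -> lead_coef h * r \in Aint.
Proof.
move=> Ah hr; case: (eqVneq h 0) => [->|h0]; first by rewrite lead_coef0 mul0r.
have [k sz] : exists k, size h = k.+2.
  have := root_size_gt1 h0 hr; case: (size h) => [|[|k]] // _; by exists k.
set a := lead_coef h; have Aa : a \in Aint by apply: (polyOverP Ah).
pose q : {poly algC} := \poly_(i < k.+1) (h`_i * a ^+ (k - i)).
apply: (@Aint_root_monic ('X^(k.+1) + q)).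
- have szq : (size q < size ('X^(k.+1) : {poly algC})%R)%N by rewrite size_polyXn ltnS size_poly.
  by apply/monicP; rewrite lead_coefDl // lead_coefXn.
- rewrite rpredD ?rpredX ?polyOverX //; apply/polyOverP=> i; rewrite coef_poly.
  by case: ifP => // _; rewrite rpredM ?rpredX // (polyOverP Ah).
rewrite /root hornerD hornerXn horner_poly.
have /eqP : a ^+ k * h.[r] = 0 by rewrite (rootP hr) mulr0.
rewrite horner_coef sz big_ord_recr /= mulrDr addrC.
have -> : h`_k.+1 = a by rewrite /a lead_coefE sz.
rewrite mulrA -exprSr -exprMn mulr_sumr.
move/eqP=> E; apply/eqP; rewrite -[RHS]E; congr (_ + _); apply: eq_bigr => i _.
have -> : a ^+ k = a ^+ (k - i) * a ^+ i by rewrite -exprD subnK // -ltnS.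
by rewrite exprMn [RHS]mulrCA !mulrA.
Qed.

(** Induction on the size of [q]: its leading coefficient [a] is also that of the product, so [a]
    and [a * r] are integral and the leading term [t] can be subtracted. *)
Lemma Aint_div_root (q : {poly algC}) (r : algC) :
  ('X - r%:P) * q \is a polyOver Aint -> q \is a polyOver Aint.
Proof.
have [n] := ubnP (size q); elim: n q => // n IH q sq Ah.
case: (eqVneq q 0) => [->|q0]; first exact: rpred0.
set a := lead_coef q; have lh : lead_coef (('X - r%:P) * q) = a.
  by rewrite lead_coefM lead_coefXsubC mul1r.
have Aar : a * r \in Aint.
  by rewrite -lh; apply: Aint_lead_root => //; rewrite rootM root_XsubC eqxx.
have Aa : a \in Aint by rewrite -lh; apply: (polyOverP Ah).
pose k := (size q).-1; pose t : {poly algC} := a *: 'X^k.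
have At : t \is a polyOver Aint by rewrite polyOverZ ?rpredX ?polyOverX.
have szk : size q = k.+1 by rewrite /k -polySpred.
rewrite -[q](subrK t) rpredD //; apply: IH.
  rewrite -ltnS; apply: leq_trans sq; rewrite ltnS szk; apply/leq_sizeP=> j kj.
  rewrite /t coefB coefZ coefXn; case: (ltngtP k j) kj => // [kj _|<- _].
    by rewrite mulr0 subr0 nth_default // szk.
  by rewrite mulr1 /a lead_coefE szk subrr.
rewrite mulrBr rpredB // /t -scalerAr mulrBl scalerBr -exprS rpredB //.
  by rewrite polyOverZ ?rpredX ?polyOverX.
by rewrite mul_polyC scalerA polyOverZ ?rpredX ?polyOverX.
Qed.

(* Peel off one root r of f at a time: if c (X - r) q is integral then so are c q
   and c r q = X (c q) - c (X - r) q. *)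
Lemma Aint_coef_prod_XsubC (rs : seq algC) (g : {poly algC}) c i j :
    c *: (\prod_(r <- rs) ('X - r%:P) * g) \is a polyOver Aint ->
  c * (\prod_(r <- rs) ('X - r%:P))`_i * g`_j \in Aint.
Proof.
elim: rs c i => [|r rs IH] c i.
  rewrite big_nil mul1r coef1 => /polyOverP/(_ j); rewrite coefZ.
  by case: i => [|i]; rewrite ?mulr1 // mulr0 mul0r.
rewrite big_cons; set P := \prod_(r0 <- rs) _ => Ah.
have Aq : c *: (P * g) \is a polyOver Aint.
  by apply: (@Aint_div_root _ r); rewrite -scalerAr mulrA.
have Arq : (c * r) *: (P * g) \is a polyOver Aint.
  have -> : (c * r) *: (P * g) = 'X * (c *: (P * g)) - c *: (('X - r%:P) * P * g).
    rewrite -mulrA -scalerAr mulrBl scalerBr subKr mul_polyC scalerA //.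
  by rewrite rpredB // rpredM ?polyOverX.
rewrite mulrBl coefB coefXM mul_polyC coefZ mulrBr mulrBl mulrA.
rewrite rpredB ?IH //; case: i => [|i] /=; first by rewrite mulr0 mul0r.
exact: IH.
Qed.

Lemma Aint_coef_mul (f g : {poly algC}) i j :
  f * g \is a polyOver Aint -> f`_i * g`_j \in Aint.
Proof.
have [rs E] := closed_field_poly_normal f; rewrite {1}E -scalerAl => Afg.
by rewrite E coefZ; apply: Aint_coef_prod_XsubC.
Qed.

(** * Integral coefficients and denominators in [L] *)

Section CoefficientIdeals.
Variable L : fieldExtType rat.

Lemma OK_coef_mul (f g : {poly L}) :
  (forall k, OK (f * g)`_k) -> forall i j, OK (f`_i * g`_j).
Proof.
have [s _] := embedding_exists L => O i j; apply/(OK_Aint s).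
rewrite rmorphM -!coef_map; apply: Aint_coef_mul; rewrite -rmorphM.
by apply/polyOverP=> k; rewrite coef_map; apply/OK_Aint.
Qed.

(** Multiply the rational minimal polynomials of the roots of [f] in [algC] and clear denominators;
    divisibility descends along the embedding [s]. *)
Lemma dvdp_int_poly (f : {poly L}) : f != 0 ->
  exists2 h : {poly int}, h != 0 & f %| map_poly intr h.
Proof.
move=> f0; have [s _] := embedding_exists L.
have [rs E] := closed_field_poly_normal (map_poly s f).
have [p p0 dp] : exists2 p : {poly rat}, p != 0 & \prod_(z <- rs) ('X - z%:P) %| map_poly ratr p.
  elim: rs {E} => [|r rs [p p0 dp]]; first by exists 1; rewrite ?oner_eq0 // big_nil dvd1p.
  have [q [Eq mq _]] := minCpolyP r.
  exists (q * p); first by rewrite mulf_neq0 // monic_neq0.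
  rewrite big_cons rmorphM dvdp_mul // dvdp_XsubCl; have := root_minCpoly r; by rewrite Eq.
have [h [a a0 Ep]] := rat_poly_scale p.
exists h; first by apply: contraNneq p0 => h0; rewrite Ep h0 rmorph0 scaler0.
rewrite -(dvdp_map s) E dvdpZl ?lead_coef_eq0 ?map_poly_eq0 //.
apply: dvdp_trans dp _; rewrite Ep linearZ /= dvdpZl; last first.
  by rewrite fmorph_eq0 invr_eq0 intr_eq0.
rewrite -!map_poly_comp (@eq_map_poly _ _ _ (s \o intr)) // => z /=.
by rewrite !rmorph_int.
Qed.

Lemma OK_denominator (x : L) : exists2 m : int, m != 0 & OK (m%:~R * x).
Proof.
have [h h0 /dvdpP[q E]] := dvdp_int_poly (negbT (polyXsubC_eq0 x)).
have [s _] := embedding_exists L.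
exists (lead_coef h); first by rewrite lead_coef_eq0.
apply/(OK_Aint s); rewrite rmorphM rmorph_int.
have -> : (lead_coef h)%:~R = lead_coef (map_poly intr h : {poly algC}).
  by rewrite lead_coef_map_inj //; apply: intr_inj.
apply: Aint_lead_root.
  by apply/polyOverP=> i; rewrite coef_map Aint_int.
have -> : map_poly intr h = map_poly s (map_poly intr h).
  by rewrite -map_poly_comp; apply: eq_map_poly => z /=; rewrite rmorph_int.
by rewrite fmorph_root E rootM root_XsubC eqxx orbT.
Qed.
End CoefficientIdeals.

(** * Finitely generated additive groups *)

Definition zsubgroup (V : zmodType) (H : V -> Prop) :=
  H 0 /\ forall x y, H x -> H y -> H (x - y).

(* Generation is phrased impredicatively so that properties stable under
   subtraction transfer from g to H without handling coefficients. *)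
Definition zfg (V : zmodType) (H : V -> Prop) := exists g : seq V,
  (forall y, y \in g -> H y) /\
  forall K, zsubgroup K -> (forall y, y \in g -> K y) -> forall x, H x -> K x.

Section Subgroups.
Variables (V : zmodType) (H : V -> Prop) (zH : zsubgroup H).

Lemma zsubgroupN x : H x -> H (- x).
Proof. by case: zH => H0 HB Hx; rewrite -sub0r; apply: HB. Qed.
Lemma zsubgroupD x y : H x -> H y -> H (x + y).
Proof. by move=> Hx /zsubgroupN Hy; rewrite -[y]opprK; case: zH => _; apply. Qed.
Lemma zsubgroupMz x (m : int) : H x -> H (x *~ m).
Proof.
move=> Hx; have Hn (n : nat) : H (x *+ n).
  elim: n => [|n IH]; first by rewrite mulr0n; case: zH.
  by rewrite mulrS; apply: zsubgroupD.
case: m => n; first by rewrite -pmulrn; apply: Hn.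
by rewrite NegzE mulrNz -pmulrn; apply/zsubgroupN/Hn.
Qed.
End Subgroups.

(** Euclidean descent: if [m] fails to divide some [x] in [H], the remainder [x %% m] is a smaller
    nonzero element of [H]. *)
Lemma int_zsubgroup_principal (H : int -> Prop) : zsubgroup H ->
  exists2 g, H g & forall m, H m -> (g %| m)%Z.
Proof.
move=> zH; have [H0 HB] := zH.
case: (classic (exists2 m, H m & m != 0)) => [[m Hm m0]|no]; last first.
  exists 0 => // m Hm; rewrite dvd0z; apply/eqP; apply: NNPP => m0.
  by apply: no; exists m => //; apply/eqP.
have [n] := ubnP `|m|%N; elim: n m m0 Hm => // n IH m m0 Hm lt_mn.
case: (classic (exists2 x, H x & ~~ (m %| x)%Z)) => [[x Hx ndvd]|no]; last first.
  by exists m => // x Hx; apply: contraT => ndvd; case: no; exists x.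
apply: (IH (x %% m)%Z).
- by apply: contra ndvd => /eqP/dvdz_mod0P.
- by rewrite /modz; apply: HB => //; rewrite mulrC -mulrzz; apply: zsubgroupMz.
- rewrite -ltz_nat gez0_abs ?modz_ge0 //; apply: lt_le_trans (ltz_mod x m0) _.
  by rewrite -abszE lez_nat -ltnS.
Qed.

(** Induction on [k]: the values of [phi k] on [H] are the multiples of some [m], and a preimage [v]
    of [m] together with generators of the kernel of [phi k] in [H] generates [H]. *)
Lemma zfg_functionals (V : zmodType) k (phi : nat -> V -> rat) (H : V -> Prop) :
    zsubgroup H ->
    (forall i x y, phi i (x - y) = phi i x - phi i y) ->
    (forall i x, (i < k)%N -> H x -> phi i x \is a Num.int) ->
    (forall x, H x -> (forall i, (i < k)%N -> phi i x = 0) -> x = 0) ->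
  zfg H.
Proof.
move=> zH phiB; elim: k H zH => [|k IH] H zH phiZ phi0.
  by exists [::]; split=> // K [K0 _] _ x Hx; rewrite (phi0 x Hx).
have [H0 HB] := zH.
have phi00 i : phi i 0 = 0 by rewrite -(subrr 0) phiB subrr.
have [|m [v Hv vm] mP] := @int_zsubgroup_principal (fun m => exists2 x, H x & phi k x = m%:~R).
  split; first by exists 0.
  by move=> a b [x Hx xa] [y Hy yb]; exists (x - y); rewrite ?phiB ?xa ?yb ?intrB //; apply: HB.
have [|||g [gH gP]] := IH (fun x => H x /\ phi k x = 0).
- split=> // x y [Hx x0] [Hy y0]; split; first exact: HB.
  by rewrite phiB x0 y0 subrr.
- by move=> i x ik [Hx _]; apply: phiZ => //; apply: ltnW.
- move=> x [Hx x0] xi; apply: phi0 => // i; rewrite ltnS leq_eqVlt.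
  by case/orP=> [/eqP->|/xi].
exists (v :: g); split=> [y|K zK Kg x Hx].
  by rewrite inE => /orP[/eqP->|/gH[]].
have phiMz y (j : int) : phi k (y *~ j) = phi k y *~ j.
  pose p : {additive V -> rat} := HB.pack (phi k)
    (GRing.isZmodMorphism.Build V rat (phi k) (phiB k)).
  exact: (raddfMz p).
have /intrP[a xa] := phiZ k x (ltnSn k) Hx.
have /dvdzP[q aq] : (m %| a)%Z by apply: mP; exists x.
have Hd : H (x - v *~ q) by apply: HB => //; apply: zsubgroupMz.
rewrite -[x](subrK (v *~ q)); apply: zsubgroupD => //.
  apply: gP => //; first by move=> y yg; apply: Kg; rewrite inE yg orbT.
  by split=> //; rewrite phiB phiMz xa vm aq -mulrzA (mulrC m) subrr.
by apply: zsubgroupMz => //; apply: Kg; rewrite mem_head.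
Qed.

(** * Fractional ideals and their inverses *)

Section Ideals.
Variable L : fieldExtType rat.
Implicit Types (I J K : idl L) (x y z : L).

Lemma mul_idl_mem I J x y : I x -> J y -> mul_idl I J (x * y).
Proof.
move=> Ix Jy; exists [:: (x, y)]; split; last by rewrite big_seq1.
by move=> p; rewrite inE => /eqP->.
Qed.

Lemma mul_idl0 I J : mul_idl I J 0.
Proof. by exists [::]; rewrite big_nil. Qed.

Lemma mul_idlD I J x y : mul_idl I J x -> mul_idl I J y -> mul_idl I J (x + y).
Proof.
move=> [s [sI ->]] [s' [sI' ->]]; exists (s ++ s'); rewrite big_cat; split=> // p.
by rewrite mem_cat => /orP[/sI|/sI'].
Qed.

Lemma mul_idl_ind I J (P : L -> Prop) :
    P 0 -> (forall x y, P x -> P y -> P (x + y)) ->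
    (forall x y, I x -> J y -> P (x * y)) ->
  forall z, mul_idl I J z -> P z.
Proof.
move=> P0 PD PM z [s [sI ->]]; rewrite big_seq; elim/big_ind: _ => //.
by move=> p /sI[]; apply: PM.
Qed.

Lemma submoduleN I x : submodule I -> I x -> I (- x).
Proof. by move=> [_ [_ IM]] Ix; rewrite -mulN1r; apply: IM => //; exact: (OK_int L (-1)). Qed.

Lemma submoduleB I x y : submodule I -> I x -> I y -> I (x - y).
Proof. by move=> sI Ix /(submoduleN sI) Iy; case: sI => _ [ID _]; apply: ID. Qed.

Lemma submodule_zsubgroup I : submodule I -> zsubgroup I.
Proof. by move=> sI; split; [case: sI | move=> x y; apply: submoduleB]. Qed.

Lemma OK_zsubgroup x : zsubgroup (fun y => OK (x * y)).
Proof.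
split; first by rewrite mulr0; apply: OK0.
by move=> y z Oy Oz; rewrite mulrBr; apply: OKB.
Qed.

Lemma common_denominator (g : seq L) :
  exists2 m : int, m != 0 & forall y, y \in g -> OK (m%:~R * y).
Proof.
elim: g => [|x g [m m0 mP]]; first by exists 1.
have [d d0 dx] := OK_denominator x.
exists (d * m) => [|y]; first by rewrite mulf_neq0.
rewrite inE intrM => /orP[/eqP->|/mP my].
  by rewrite mulrAC mulrC; apply: OKM dx; apply: OK_int.
by rewrite -mulrA; apply: OKM my; apply: OK_int.
Qed.

(** The functionals pair [d * x] with integral multiples of a rational basis. The factor [d] is a
    denominator for a fractional ideal, and 1 for the codifferent. *)
Lemma zfg_trace I (d : L) : d != 0 -> zsubgroup I ->
  (forall x y, I x -> OK y -> nf_trace (d * x * y) \is a Num.int) -> zfg I.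
Proof.
move=> d0 zI trI; pose e := vbasis {:L}.
have [m m0 me] := common_denominator e.
apply: (@zfg_functionals _ (\dim {:L}) (fun i x => nf_trace (d * x * (m%:~R * e`_i)))) => //.
- by move=> i x y; rewrite mulrBr mulrBl nf_traceB.
- by move=> i x il Ix; apply: trI => //; apply: me; rewrite mem_nth ?size_tuple.
move=> x Ix tr0; apply/eqP; apply: contraT => x0.
have dx0 : d * x * m%:~R != 0 by rewrite !mulf_neq0 ?intL_neq0.
(* Vanishing against a basis gives vanishing against all of [L], in particular against the
   inverse. *)
have : nf_trace (d * x * m%:~R * (d * x * m%:~R)^-1) = 0.
  rewrite (coord_basis (vbasisP {:L}) (memvf (d * x * m%:~R)^-1)).
  rewrite mulr_sumr; elim/big_ind: _ => [|y z Ey Ez|i _].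
  - by rewrite /nf_trace !raddf0.
  - by rewrite -[z]opprK nf_traceB /nf_trace !raddfN /= -!/(nf_trace _) Ey Ez oppr0 subrr.
  - rewrite -scalerAr -(mulrA _ m%:~R) /nf_trace linearZ linearZ /=.
    by rewrite -/(nf_trace _) tr0 // mulr0.
by move/eqP; rewrite (negPf (nf_trace_nondegenerate dx0)).
Qed.

Lemma frac_ideal_zfg I : frac_ideal I -> zfg I.
Proof.
case=> sI [_ [d [d0 [Od dI]]]]; apply: (zfg_trace d0 (submodule_zsubgroup sI)).
by move=> x y Ix Oy; apply: nf_trace_int; apply: OKM => //; apply: dI.
Qed.

Lemma zfg_invertible I : submodule I -> (exists x, x != 0 /\ I x) -> zfg I ->
  mul_idl I (inv_idl I) 1.
Proof.
move=> sI [x0 [x0n Ix0]] [a [aI aP]]; pose f := Poly a.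
have aE y : y \in a -> exists i, y = f`_i.
  by move=> ya; exists (index y a); rewrite coef_Poly nth_index.
have fI i : I f`_i.
  rewrite coef_Poly; case: (ltnP i (size a)) => [ia|ai]; last by rewrite nth_default //; case: sI.
  by apply: aI; rewrite mem_nth.
have f0 : f != 0.
  apply: contraNneq x0n => f0; apply/eqP; apply: (aP (fun x => x = 0)) => //.
    by split=> // x y -> ->; rewrite subrr.
  by move=> y /aE[i ->]; rewrite f0 coef0.
have [h h0 /dvdpP[q E]] := dvdp_int_poly f0.
pose J : idl L := fun y => exists j (u : int), y = u%:~R * q`_j.
(* [g] generates the rational integers in [I J]. It divides the coefficients of [f q], which lie
   there; its own membership is the Bezout relation. *)
have [|g Hg gP] := @int_zsubgroup_principal (fun m => mul_idl I J m%:~R).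
  split=> [|m m' Hm Hm']; first exact: mul_idl0.
  rewrite intrB; apply: mul_idlD => //; elim/(@mul_idl_ind I J): Hm' => /=.
  - by rewrite oppr0; apply: mul_idl0.
  - by move=> x y Hx Hy; rewrite opprD; apply: mul_idlD.
  - move=> x y Ix [j [u ->]]; rewrite -mulNr; apply: mul_idl_mem; first exact: submoduleN.
    by exists j, u.
have gh i : (g %| h`_i)%Z.
  apply: gP; rewrite -coef_map E mulrC coefM; elim/big_ind: _ => [|x y|k _].
  - exact: mul_idl0.
  - exact: mul_idlD.
  - by apply: mul_idl_mem => //; exists (i - k)%N, 1; rewrite mul1r.
have g0 : g != 0.
  apply: contraNneq h0 => g0; apply/eqP/polyP=> i; have := gh i.
  by rewrite g0 dvd0z coef0 => /eqP.
have gL0 : g%:~R != 0 :> L := intL_neq0 L g0.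
(* [f] times [q / g] has rational integer coefficients, so by the Prague theorem the coefficients of
   [q / g] lie in the inverse of [I]. *)
have Oc : forall i j, OK (f`_i * (g%:~R^-1 *: q)`_j).
  apply: OK_coef_mul => k; rewrite -scalerAr mulrC -E coefZ coef_map /=.
  have /dvdzP[u ->] := gh k; rewrite intrM mulrC mulfK //; exact: OK_int.
have qinv j u : inv_idl I (u%:~R * q`_j / g%:~R).
  move=> x; apply: (aP (fun x => OK (u%:~R * q`_j / g%:~R * x))); first exact: OK_zsubgroup.
  move=> y /aE[i ->]; have := Oc i j; rewrite coefZ => Oij.
  rewrite -mulrA -mulrA; apply: OKM; first exact: OK_int.
  by rewrite mulrA mulrC (mulrC q`_j).
rewrite -(divff gL0).
apply: (@mul_idl_ind I J (fun z => mul_idl I (inv_idl I) (z / g%:~R))) Hg.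
- by rewrite mul0r; apply: mul_idl0.
- by move=> x y Hx Hy; rewrite mulrDl; apply: mul_idlD.
- by move=> x y Ix [j [u ->]]; rewrite -mulrA; apply: mul_idl_mem => //; apply: qinv.
Qed.

Lemma frac_ideal_invertible I : frac_ideal I -> mul_idl I (inv_idl I) 1.
Proof.
by move=> fI; have [sI [xI _]] := fI; apply: zfg_invertible => //; apply: frac_ideal_zfg.
Qed.

Lemma submodule_inv I : submodule (inv_idl I).
Proof.
split; first by move=> y _; rewrite mul0r; apply: OK0.
split=> [x y Hx Hy z Iz|r x Or Hx z Iz].
  by rewrite mulrDl; apply: OKD; [apply: Hx | apply: Hy].
by rewrite -mulrA; apply: OKM => //; apply: Hx.
Qed.

Lemma submodule_mul I J : submodule I -> submodule (mul_idl I J).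
Proof.
move=> [_ [_ IM]]; split; first exact: mul_idl0.
split=> [x y|r x Or]; first exact: mul_idlD.
elim/mul_idl_ind=> [|y z Hy Hz|y z Iy Jz].
- by rewrite mulr0; apply: mul_idl0.
- by rewrite mulrDr; apply: mul_idlD.
- by rewrite mulrA; apply: mul_idl_mem => //; apply: IM.
Qed.

Lemma submodule_sum I J : submodule I -> submodule J -> submodule (sum_idl I J).
Proof.
move=> [I0 [ID IM]] [J0 [JD JM]]; split; first by exists 0, 0; rewrite addr0.
split=> [_ _ [x [y [Ix [Jy ->]]]] [x' [y' [Ix' [Jy' ->]]]]|r _ Or [x [y [Ix [Jy ->]]]]].
  by exists (x + x'), (y + y'); rewrite addrACA; do !split; [apply: ID | apply: JD].
by exists (r * x), (r * y); rewrite mulrDr; do !split; [apply: IM | apply: JM].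
Qed.

Lemma submodule_scale a I : submodule I -> submodule (scale_idl a I).
Proof.
move=> [I0 [ID IM]]; split; first by exists 0; rewrite mulr0.
split=> [_ _ [x [Ix ->]] [y [Iy ->]]|r _ Or [x [Ix ->]]].
  by exists (x + y); rewrite mulrDr; split=> //; apply: ID.
by exists (r * x); rewrite mulrCA; split=> //; apply: IM.
Qed.

Lemma submodule_OK : submodule (@OK L).
Proof. by split; [apply: OK0 | split; [apply: OKD | apply: OKM]]. Qed.

Lemma frac_ideal_inv I : frac_ideal I -> frac_ideal (inv_idl I).
Proof.
move=> [[I0 [ID IM]] [[x [x0 Ix]] [d [d0 [Od dI]]]]]; split; first exact: submodule_inv.
split; first by exists d; split.
(* This denominator is an element of [I] itself, which the inverse sends into the integers. *)
exists (d * x); split; first by rewrite mulf_neq0.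
split=> [|y Hy]; first exact: dI.
by rewrite mulrC; apply: Hy; apply: IM.
Qed.

Lemma frac_ideal_mul I J : frac_ideal I -> frac_ideal J -> frac_ideal (mul_idl I J).
Proof.
move=> [sI [[x [x0 Ix]] [d [d0 [Od dI]]]]] [sJ [[y [y0 Jy]] [e [e0 [Oe eJ]]]]].
split; first exact: submodule_mul.
split; first by exists (x * y); rewrite mulf_neq0 //; split=> //; apply: mul_idl_mem.
exists (d * e); rewrite mulf_neq0 //; split=> //; split; first exact: OKM.
move=> z; elim/mul_idl_ind=> [|u v Hu Hv|u v Iu Jv].
- by rewrite mulr0; apply: OK0.
- by rewrite mulrDr; apply: OKD.
- by rewrite mulrACA; apply: OKM; [apply: dI | apply: eJ].
Qed.

(** The trace condition shows no denominator; finite generation through the trace form gives one, as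
    a common denominator of the generators. *)
Lemma frac_ideal_codifferent : frac_ideal (@codifferent L).
Proof.
have sC : submodule (@codifferent L).
  split; first by move=> y _; rewrite mul0r; have := nf_traceB (0 : L) 0; rewrite !subrr => ->.
  split=> [x y Hx Hy z Oz|r x Or Hx z Oz].
    have -> : nf_trace ((x + y) * z) = nf_trace (x * z) + nf_trace (y * z).
      by rewrite mulrDl /nf_trace !raddfD.
    by rewrite rpredD ?Hx ?Hy.
  by rewrite mulrAC mulrC; apply: Hx; rewrite mulrC; apply: OKM.
split=> //; split.
  exists 1; split; first exact: oner_neq0.
  by move=> y Oy; rewrite mul1r; apply: nf_trace_int.
have [|g [gC gP]] := @zfg_trace (@codifferent L) 1 (oner_neq0 L) (submodule_zsubgroup sC).
  by move=> x y Cx Oy; rewrite mul1r; apply: Cx.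
have [m m0 mg] := common_denominator g.
exists m%:~R; split; first exact: intL_neq0.
split; first exact: OK_int.
by move=> x; apply: (gP (fun x => OK (m%:~R * x))) => //; apply: OK_zsubgroup.
Qed.

Lemma frac_ideal_different : frac_ideal (@different L).
Proof. exact: frac_ideal_inv frac_ideal_codifferent. Qed.

End Ideals.

(** * The line of the first column in the lattice *)

Section LineInLattice.
Variables (L : fieldExtType rat) (D n : idl L) (a c : L).
Hypotheses (fD : frac_ideal D) (hn : integral_ideal n) (ac0 : a != 0 \/ c != 0).

Local Notation Di := (inv_idl D).
Local Notation b := (sum_idl (principal a) (scale_idl c Di)).
Local Notation E := (inv_idl (mul_idl D b)).
Local Notation m := (sum_idl (scale_idl c E) n).

Let sn : submodule n := proj1 (proj1 hn).

Lemma column_ideal_fst : b a.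
Proof.
exists a, 0; split; first by exists 1; rewrite mulr1; split=> //; apply: OK1.
by rewrite addr0; split=> //; exists 0; rewrite mulr0; split=> //; case: (submodule_inv D).
Qed.

Lemma column_ideal_snd k : Di k -> b (c * k).
Proof.
move=> Dk; exists 0, (c * k); split; last by rewrite add0r; split=> //; exists k.
by exists 0; rewrite mulr0; split=> //; apply: OK0.
Qed.

Lemma frac_ideal_column : frac_ideal b.
Proof.
have [_ [[k [k0 Dk]] [d [d0 [Od dD]]]]] := frac_ideal_inv fD.
split.
  by apply: submodule_sum; apply: submodule_scale; [apply: submodule_OK | apply: submodule_inv].
split.
  case: ac0 => [a0|c0]; first by exists a; split=> //; apply: column_ideal_fst.
  by exists (c * k); split; [rewrite mulf_neq0 | apply: column_ideal_snd].
have [p p0 Op] := OK_denominator a; have [q q0 Oq] := OK_denominator c.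
exists (p%:~R * q%:~R * d); split; first by rewrite !mulf_neq0 ?intL_neq0.
have Oi := OK_int L.
split; first by do !apply: OKM.
move=> _ [_ [_ [[r [Or ->]] [[l [Dl ->]] ->]]]].
rewrite [X in OK X](_ : _ =
  q%:~R * d * r * (p%:~R * a) + p%:~R * (q%:~R * c) * (d * l)); last by ring.
exact: OKD (OKM (OKM (OKM (Oi q) Od) Or) Op) (OKM (OKM (Oi p) Oq) (dD _ Dl)).
Qed.

Let bi_inv : mul_idl b (inv_idl b) 1 := frac_ideal_invertible frac_ideal_column.
Let D_inv : mul_idl D Di 1 := frac_ideal_invertible fD.

Lemma inv_mul_inv f k : inv_idl b f -> Di k -> E (f * k).
Proof.
move=> bf Dk w; elim/mul_idl_ind=> [|u v|u v Du bv].
- by rewrite mulr0; apply: OK0.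
- by rewrite mulrDr; apply: OKD.
- rewrite [X in OK X](_ : _ = k * u * (f * v)); last by ring.
  by apply: OKM; [apply: Dk | apply: bf].
Qed.

Lemma column_mul_inv u h : b u -> E h -> Di (u * h).
Proof.
move=> bu Eh d Dd; rewrite (_ : u * h * d = h * (d * u)); last by ring.
by apply: Eh; apply: mul_idl_mem.
Qed.

(** This is the integrality of [c_A]: write 1 as a sum of products [d * k] from [D] and its inverse,
    and use that [c * k] lies in [b]. *)
Lemma OK_snd_mul_inv h : E h -> OK (c * h).
Proof.
move=> Eh; rewrite -[c * h]mulr1.
apply: (@mul_idl_ind _ D Di (fun w => OK (c * h * w))) D_inv => [|u v|d k Dd Dk].
- by rewrite mulr0; apply: OK0.
- by rewrite mulrDr; apply: OKD.
- rewrite [X in OK X](_ : _ = c * k * h * d); last by ring.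
  exact: (column_mul_inv (column_ideal_snd Dk) Eh Dd).
Qed.

(** Coprimality of [a_A] and [c_A]: expand 1 in [b] times its inverse; a term [(a * r + c * k) * g]
    contributes [r * g] to [f] and [g * k] to [h]. *)
Lemma column_bezout : exists f h, [/\ inv_idl b f, E h & a * f + c * h = 1].
Proof.
apply: (@mul_idl_ind _ b (inv_idl b)
  (fun w => exists f h, [/\ inv_idl b f, E h & a * f + c * h = w])) bi_inv.
- have [[b0 _] [E0 _]] := (submodule_inv b, submodule_inv (mul_idl D b)).
  by exists 0, 0; rewrite !mulr0 addr0.
- have [[_ [bD _]] [_ [ED _]]] := (submodule_inv b, submodule_inv (mul_idl D b)).
  move=> _ _ [f [h [bf Eh <-]]] [f' [h' [bf' Eh' <-]]].
  by exists (f + f'), (h + h'); rewrite !mulrDr addrACA; split; [apply: bD | apply: ED |].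
- move=> _ g [_ [_ [[r [Or ->]] [[k [Dk ->]] ->]]]] bg.
  exists (r * g), (g * k); split; last by ring.
  + by have [_ [_]] := submodule_inv b; apply.
  + exact: inv_mul_inv.
Qed.

Lemma mul_idl_by_inv I w : (forall k, Di k -> I (w * k)) -> mul_idl D I w.
Proof.
move=> Iw; rewrite -[w]mulr1.
apply: (@mul_idl_ind _ D Di (fun x => mul_idl D I (w * x))) D_inv => [|u v|d k Dd Dk].
- by rewrite mulr0; apply: mul_idl0.
- by rewrite mulrDr; apply: mul_idlD.
- by rewrite mulrCA; apply: mul_idl_mem => //; apply: Iw.
Qed.

Lemma frac_ideal_level : frac_ideal m.
Proof.
have [[_ [[x [x0 nx]] _]] nO] := hn.
split; first by apply: submodule_sum => //; apply: submodule_scale; apply: submodule_inv.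
split.
  exists x; split=> //; exists 0, x; rewrite add0r; split=> //.
  by exists 0; rewrite mulr0; split=> //; case: (submodule_inv (mul_idl D b)).
exists 1; rewrite oner_neq0; split=> //; split; first exact: OK1.
move=> _ [_ [y [[h [Eh ->]] [ny ->]]]]; rewrite mul1r.
by apply: OKD; [apply: OK_snd_mul_inv | apply: nO].
Qed.

Lemma level_of_n x : n x -> m x.
Proof.
move=> nx; exists 0, x; rewrite add0r; split=> //.
by exists 0; rewrite mulr0; split=> //; case: (submodule_inv (mul_idl D b)).
Qed.

Lemma level_of_c h : E h -> m (c * h).
Proof.
by move=> Eh; exists (c * h), 0; rewrite addr0; split; [exists h | split=> //; case: sn].
Qed.

(** For integral [x] the summand [n] of [m] is harmless, so membership in [n / m] is tested on [c_A]
    alone. The converse multiplies by 1, expanded in [m] times its inverse. *)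
Lemma mul_n_inv_level x : OK x -> mul_idl n (inv_idl m) x <-> forall h, E h -> n (x * (c * h)).
Proof.
have [n0 [nD nM]] := sn; move=> Ox; split=> [nx h Eh|nx].
  move: nx; apply: (@mul_idl_ind _ _ _ (fun x => n (x * (c * h)))) => [|u v|u v nu mv].
  - by rewrite mul0r.
  - by rewrite mulrDl; apply: nD.
  - rewrite -mulrA mulrC; apply: nM => //; apply: mv; exact: level_of_c.
rewrite -[x]mulr1; have := frac_ideal_invertible frac_ideal_level.
apply: (@mul_idl_ind _ m _ (fun w => mul_idl n (inv_idl m) (x * w))) => [|u v|u v mu mv].
- by rewrite mulr0; apply: mul_idl0.
- by rewrite mulrDr; apply: mul_idlD.
- rewrite mulrA; apply: mul_idl_mem => //.
  have [_ [y [[h [Eh ->]] [ny ->]]]] := mu.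
  by rewrite mulrDr; apply: nD; [apply: nx | apply: nM].
Qed.

Lemma eigenvalue_congruences (al be ga de x z : L) :
    OK al -> OK de -> OK x -> mul_idl D n ga -> Di be -> n (de - 1) ->
    al * a + be * c = a * x -> ga * a + de * c = c * x -> al + de = x + z ->
  m (z - 1) /\ mul_idl n (inv_idl m) (x - 1).
Proof.
move=> Oal Ode Ox Dga Dbe nde E1 E2 Etr; have [n0 [nD nM]] := sn.
have [sm _] := frac_ideal_level; have [_ [mD mM]] := sm.
have [f [h [bf Eh fh1]]] := column_bezout; split; last first.
  apply/mul_n_inv_level => [|k Ek]; first by apply: OKB => //; apply: OK1.
  (* [E2] replaces [c * x]. The first term is in [n] because [ga] is in [D n] and [a * k] in the
     inverse of [D]. *)
  have -> : (x - 1) * (c * k) = ga * (a * k) + c * k * (de - 1).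
    have -> : (x - 1) * (c * k) = c * x * k - c * k by ring.
    by rewrite -E2; ring.
  apply: (nD); last by apply: nM => //; apply: OK_snd_mul_inv.
  have Dak := column_mul_inv column_ideal_fst Ek.
  move: Dga; apply: (@mul_idl_ind _ _ _ (fun w => n (w * (a * k)))) => [|u v|u v Du nv].
  - by rewrite mul0r.
  - by rewrite mulrDl; apply: nD.
  - by rewrite mulrAC mulrC mulrC (mulrC u); apply: nM => //; apply: Dak.
(* The trace relation moves the question to [al - x]. Splitting 1 as [a * f + c * h], [E1] turns the
   first part into a multiple of [c] by an element of [E]; the second already is one. *)
have -> : z - 1 = (al - x) * 1 + (de - 1).
  have -> : z - 1 = x + z - x - 1 by ring.
  by rewrite -Etr; ring.
apply: (mD); last exact: level_of_n.
rewrite -fh1 mulrDr; apply: mD; last by apply: mM; [apply: OKB | apply: level_of_c].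
have -> : (al - x) * (a * f) = c * - (f * be).
  have -> : (al - x) * (a * f) = (al * a - a * x) * f by ring.
  by rewrite -E1; ring.
apply: level_of_c; apply: (submoduleN (submodule_inv _)).
exact: inv_mul_inv.
Qed.

(* In the unimodular frame (a, -h; c, f) every conjugate of (x, y; 0, z) is explicit;
   y is chosen to cancel the c_A-part of z - 1 in the lower row. *)
Lemma eigenvalue_realization (x z : L) :
    OK x -> OK z -> m (z - 1) -> mul_idl n (inv_idl m) (x - 1) ->
  exists f h y : L, a * f + c * h = 1 /\
    [/\ OK (a * f * x + c * h * z - a * c * y),
        Di (a * (a * y + h * (x - z))),
        mul_idl D n (c * (f * (x - z) - c * y)),
        OK (a * f * z + c * h * x + a * c * y)
      & n (a * f * z + c * h * x + a * c * y - 1)].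
Proof.
move=> Ox Oz [_ [nu [[k [Ek ->]] [nnu zE]]]] nx.
have [n0 [nD nM]] := sn; have nO := proj2 hn.
have Ox1 : OK (x - 1) by apply: OKB => //; apply: OK1.
have {}nx := (mul_n_inv_level Ox1).1 nx.
have {zE} zE : z = c * k + nu + 1 by rewrite -zE subrK.
have [f [h [bf Eh fh1]]] := column_bezout.
have Oaf : OK (a * f) by rewrite mulrC; apply: bf; apply: column_ideal_fst.
have Och := OK_snd_mul_inv Eh; have Ock := OK_snd_mul_inv Ek.
have Oacy : OK (a * c * - (f * k)).
  by rewrite [X in OK X](_ : _ = - (a * f * (c * k))); [apply: OKN; apply: OKM | ring].
have [_ [DD DM]] := submodule_inv D.
have nde : n (a * f * z + c * h * x + a * c * - (f * k) - 1).
  rewrite -fh1 [X in n X](_ : _ = a * f * nu + (x - 1) * (c * h)); last by rewrite zE; ring.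
  by apply: nD; [apply: nM | apply: nx].
exists f, h, (- (f * k)); split=> //; split=> //.
- by apply: OKB => //; apply: OKD; apply: OKM.
- rewrite [X in inv_idl D X](_ : _ = (- (a * f)) * (a * k) + (x - z) * (a * h)); last by ring.
  by apply: DD; apply: DM; do ?[apply: OKN | apply: OKB] => //;
    apply: column_mul_inv column_ideal_fst _.
(* Tested against [l] in the inverse of [D], the entry becomes [c * (f * l)] times [x - 1 - nu],
   with [f * l] in [E]. *)
- apply: mul_idl_by_inv => l Dl.
  rewrite [X in n X](_ : _ = (x - 1) * (c * (f * l)) + (- (c * (f * l))) * nu);
    last by rewrite zE; ring.
  have Efl := inv_mul_inv bf Dl.
  by apply: nD; [apply: nx | apply: nM => //; apply: OKN; apply: OK_snd_mul_inv].
- by do !apply: OKD => //; apply: OKM.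
Qed.

End LineInLattice.

(** * Entries, determinants and signs *)

Section Matrices.
Variable L : fieldExtType rat.
Implicit Types A B g : 'M[L]_2.

Lemma mulmx2E A B :
  [/\ e11 (A *m B) = e11 A * e11 B + e12 A * e21 B,
      e12 (A *m B) = e11 A * e12 B + e12 A * e22 B,
      e21 (A *m B) = e21 A * e11 B + e22 A * e21 B
    & e22 (A *m B) = e21 A * e12 B + e22 A * e22 B].
Proof.
rewrite /e11 /e12 /e21 /e22 !mxE !big_ord_recr !big_ord0 /= !add0r.
by have -> : widen_ord (leqnSn 1) ord_max = ord0 by apply: val_inj.
Qed.

Lemma mx2P A B :
  e11 A = e11 B -> e12 A = e12 B -> e21 A = e21 B -> e22 A = e22 B -> A = B.
Proof.
move=> E11 E12 E21 E22; apply/matrixP=> i j.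
have o2 (k : 'I_2) : k = ord0 \/ k = ord_max.
  by case: k => [[|[|k]] lt] //; [left | right]; apply: val_inj.
by case: (o2 i) => ->; case: (o2 j) => ->.
Qed.

Lemma det_mx2 A : \det A = e11 A * e22 A - e12 A * e21 A.
Proof.
rewrite (expand_det_row _ ord0) !big_ord_recr big_ord0 /= add0r.
rewrite /cofactor !det_mx11 !mxE /= expr0 expr1 mul1r mulN1r mulrN.
by congr (_ * _ - _ * _); congr (A _ _); apply: val_inj.
Qed.

Lemma upperE (x y z : L) :
  [/\ e11 (upper x y z) = x, e12 (upper x y z) = y, e21 (upper x y z) = 0
    & e22 (upper x y z) = z].
Proof. by rewrite /e11 /e12 /e21 /e22 !mxE. Qed.

Lemma det_upper (x y z : L) : \det (upper x y z) = x * z.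
Proof. by rewrite det_mx2; have [-> -> -> ->] := upperE x y z; rewrite mulr0 subr0. Qed.

Lemma totpos_neq0 (x : L) : totpos x -> x != 0.
Proof.
have [s _] := embedding_exists L; move/(_ s); apply: contraTneq => ->.
by rewrite rmorph0 ltxx.
Qed.

(** The two elements differ by the factor [x ^+ 2], positive under every embedding because all
    embeddings are real. *)
Lemma totpos_mul_div (hreal : totally_real L) (x z : L) :
  x != 0 -> totpos (x * z) <-> totpos (z / x).
Proof.
move=> x0; have sq (s : {rmorphism L -> algC}) : 0 < s x ^+ 2.
  by rewrite real_exprn_even_gt0 //= fmorph_eq0.
have E (s : {rmorphism L -> algC}) : (0 < s (x * z)) = (0 < s (z / x)).
  have -> : x * z = x ^+ 2 * (z / x) by field.
  by rewrite rmorphM rmorphXn pmulr_rgt0.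
by split=> px s; have := px s; rewrite E.
Qed.

End Matrices.

(** * From fixed classes to pairs of units and back *)

Unset Implicit Arguments.

Theorem theorem3p3 (L : fieldExtType rat) (hreal : totally_real L)
  (n : idl L) (hn : integral_ideal n)
  (t : idl L) (ht : frac_ideal t) (htn : coprime_frac t n)
  (A : 'M[L]_2) (hA : GLp A) :
  (exists x y z : L,
      GLp (upper x y z) /\ nf_norm z < 0 /\
      exists g : 'M[L]_2, Gamma1 t n g /\ A *m upper x y z = g *m A)
  <-> ~ admissible t n A.
Proof.
have fD := frac_ideal_mul ht (frac_ideal_different L).
have dA0 := totpos_neq0 hA.
have ac0 : e11 A != 0 \/ e21 A != 0.
  apply/orP; rewrite -negb_and; apply: contra dA0 => /andP[/eqP a0 /eqP c0].
  by rewrite det_mx2 a0 c0 mul0r mulr0 subrr.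
split=> [[x [y [z [pxz [Nz [g [Gg AU]]]]]]]|].
  apply; rewrite /GLp det_upper in pxz.
  have [pg [Oal [Ode [Dga [Dbe [Ug nde]]]]]] := Gg.
  have Eg : \det g = x * z.
    by apply: (mulIf dA0); rewrite -det_mulmx -AU det_mulmx det_upper mulrC.
  have [R11 R12 R21 R22] := mulmx2E A (upper x y z).
  have [S11 S12 S21 S22] := mulmx2E g A.
  have [U11 U12 U21 U22] := upperE x y z.
  rewrite AU {}S11 {}U11 {}U21 mulr0 addr0 in R11.
  rewrite AU {}S12 {}U12 {}U22 in R12.
  have [U11 U12 U21 U22] := upperE x y z.
  rewrite AU {}S21 {}U11 {}U21 mulr0 addr0 in R21.
  rewrite AU {}S22 {}U12 {}U22 in R22.
  (* Conjugate matrices have equal traces; after scaling by the determinant of [A], this compares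
     the trace of [g A] times the adjugate of [A]. *)
  have Etr : e11 g + e22 g = x + z.
    apply: (mulIf dA0); rewrite det_mx2.
    rewrite [LHS](_ : _ = (e11 g * e11 A + e12 g * e21 A) * e22 A
      - (e11 g * e12 A + e12 g * e22 A) * e21 A
      + (e21 g * e12 A + e22 g * e22 A) * e11 A
      - (e21 g * e11 A + e22 g * e21 A) * e12 A); last by ring.
    by rewrite R11 R12 R21 R22; ring.
  have [xz0 [Oxz Oxzi]] : OKunit (x * z) by rewrite -Eg.
  move: (xz0); rewrite mulf_eq0 negb_or => /andP[x0 z0].
  have Otr : OK (x + z) by rewrite -Etr; apply: OKD.
  (* [x] and [z] are the roots of the characteristic polynomial of [g], whose coefficients are
     integral. *)
  have Ox : OK x by apply: (OK_quadratic Otr Oxz); ring.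
  have Oz : OK z by apply: (OK_quadratic Otr Oxz); ring.
  have Ux : OKunit x.
    split=> //; split=> //; rewrite (_ : x^-1 = z * (x * z)^-1); first exact: OKM.
    by field; rewrite x0 z0.
  have Uz : OKunit z.
    split=> //; split=> //; rewrite (_ : z^-1 = x * (x * z)^-1); first exact: OKM.
    by field; rewrite x0 z0.
  have [mz nx] := eigenvalue_congruences fD hn ac0 Oal Ode Ox Dga Dbe nde R11 R21 Etr.
  have Nz1 : nf_norm z = -1 by case: (nf_norm_unit Uz) => [E|//]; move: Nz; rewrite E ltr10.
  exists z, x; split=> //; split=> //; last by apply/(totpos_mul_div hreal _ x0).
  (* The product [x * z] has positive norm, so the norm of [x] shares the sign of that of [z]. *)
  have := nf_norm_totpos pxz; rewrite nf_normM Nz1.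
  by have [->|//] := nf_norm_unit Ux; rewrite mul1r oppr_gt0 ltr10.
move=> /NNPP[z [x [Uz Ux mz nx [Nz Nx pzx]]]].
have [x0 [Ox Oxi]] := Ux; have [z0 [Oz Ozi]] := Uz.
have pxz : totpos (x * z) by apply/(totpos_mul_div hreal _ x0).
have [f [h [y [fh1 [Oal Dbe Dga Ode nde]]]]] := eigenvalue_realization fD hn ac0 Ox Oz mz nx.
set a := e11 A in fh1 Oal Dbe Dga Ode nde; set c := e21 A in fh1 Oal Dbe Dga Ode nde.
set b := e12 A; set d := e22 A.
(* [g] is (x, y; 0, z) conjugated by the matrix (a, -h; c, f) of determinant 1. *)
pose g : 'M[L]_2 := \matrix_(i, j)
  if i == ord0 then if j == ord0 then a * f * x + c * h * z - a * c * y
                    else a * (a * y + h * (x - z))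
  else if j == ord0 then c * (f * (x - z) - c * y)
       else a * f * z + c * h * x + a * c * y.
have [g11 g12 g21 g22] : [/\ e11 g = a * f * x + c * h * z - a * c * y,
    e12 g = a * (a * y + h * (x - z)), e21 g = c * (f * (x - z) - c * y)
  & e22 g = a * f * z + c * h * x + a * c * y].
  by rewrite /e11 /e12 /e21 /e22 !mxE.
(* In that frame [A] becomes (1, s; 0, det A) with s = f b + h d; conjugating (x, y; 0, z) back by
   it changes only the upper right entry, to [y']. *)
pose y' := (x - z) * (f * b + h * d) + y * (a * d - b * c).
have AU : A *m upper x y' z = g *m A.
  have [R11 R12 R21 R22] := mulmx2E A (upper x y' z).
  have [S11 S12 S21 S22] := mulmx2E g A.
  have [U11 U12 U21 U22] := upperE x y' z.
  apply: mx2P.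
  - rewrite R11 S11 U11 U21 g11 g12 -/a -/b -/c.
    (* Replacing a factor 1 by [a * f + c * h] makes this a polynomial identity; the other three
       entries go the same way. *)
    by rewrite -[a * x]mulr1 -fh1; ring.
  - rewrite R12 S12 U12 U22 g11 g12 -/a -/b -/c -/d.
    by rewrite -[b * z]mulr1 -fh1 /y'; ring.
  - rewrite R21 S21 U11 U21 g21 g22 -/a -/d -/c.
    by rewrite -[c * x]mulr1 -fh1; ring.
  - rewrite R22 S22 U12 U22 g21 g22 -/b -/c -/d.
    by rewrite -[d * z]mulr1 -fh1 /y'; ring.
have Eg : \det g = x * z.
  by apply: (mulIf dA0); rewrite -det_mulmx -AU det_mulmx det_upper mulrC.
exists x, y', z; split; first by rewrite /GLp det_upper.
split; first by rewrite Nz oppr_lt0 ltr01.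
exists g; split=> //; split; first by rewrite /GLp Eg.
rewrite g11 g12 g21 g22 Eg; do !split=> //; rewrite ?mulf_neq0 //; first exact: OKM.
by rewrite invfM; apply: OKM.
Qed.
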